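(* Let $\mathcal{X},\mathcal{Y}$ be finite-dimensional Euclidean spaces, $K:\mathcal{X}\to\mathcal{Y}$ a linear operator, and let $f$ on $\mathcal{Y}$ and $g$ on $\mathcal{X}$ be proper, convex, lower semicontinuous functions such that $f^*$ is $\mu_{f^*}$-strongly convex and $g$ is $\mu_g$-strongly convex. Let $\ell(x,y)=\ell_1(x)+\ell_2(y)$, $\ell:\mathcal{X}\times\mathcal{Y}\to\mathbb{R}_+$, where $\nabla\ell_1$ is $L_1$-Lipschitz and $\nabla\ell_2$ is $L_2$-Lipschitz. Let $(\tilde{x},\tilde{y})\in\mathcal{X}\times\mathcal{Y}$ be such that $\nabla^2g(\tilde{x})$ and $\nabla^2f^*(\tilde{y})$ exist, and let $(\bar{X},\bar{Y})$ be the unique saddle point of $$\min_{X\in\mathcal{X}}\max_{Y\in\mathcal{Y}}\ \langle KX,Y\rangle+\tfrac12\langle\nabla^2g(\tilde{x})X,X\rangle-\tfrac12\langle\nabla^2f^*(\tilde{y})Y,Y\rangle+\langle\nabla\ell_1(\tilde{x}),X\rangle+\langle\nabla\ell_2(\tilde{y}),Y\rangle.$$ Then for all $(X,Y)\in\mathcal{X}\times\mathcal{Y}$, $$\|X-\bar{X}\|\le\delta_1(X,\tilde{x},\tilde{y}):=\frac{\|\bar{B}_1X+\nabla\ell_1(\tilde{x})+K^*\nabla^2f^*(\tilde{y})^{-1}\nabla\ell_2(\tilde{y})\|}{\mu_g},$$ $$\|Y-\bar{Y}\|\le\delta_2(Y,\tilde{x},\tilde{y}):=\frac{\|\bar{B}_2Y+K\nabla^2g(\tilde{x})^{-1}\nabla\ell_1(\tilde{x})-\nabla\ell_2(\tilde{y})\|}{\mu_{f^*}},$$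 where $\bar{B}_1=\nabla^2g(\tilde{x})+K^*\nabla^2f^*(\tilde{y})^{-1}K$ and $\bar{B}_2=K\nabla^2g(\tilde{x})^{-1}K^*+\nabla^2f^*(\tilde{y})$.
   Context: $\|\cdot\|$ is the Euclidean norm, $K^*$ is the adjoint of $K$, and $f^*$ is the convex conjugate of $f$. Hessians of convex functions are understood in the sense of Alexandrov: $\nabla^2 g(x)$ exists if the set-valued map $\partial g$ is differentiable at $x$ (in particular $\partial g(x)$ is the single vector $\nabla g(x)$), and then $\nabla^2 g(x)=\nabla(\nabla g)(x)$, a symmetric matrix; it is non-singular if $g$ is strongly convex (its eigenvalues are then at least the strong convexity constant). *)

(* Defs.v *)
From HB Require Import structures.
From mathcomp Require Import all_boot all_order all_algebra.
From mathcomp Require Import all_classical all_reals all_analysis.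

Set Implicit Arguments.
Unset Strict Implicit.
Unset Printing Implicit Defensive.

Import Order.TTheory GRing.Theory Num.Theory.
Import numFieldNormedType.Exports.

Local Open Scope classical_set_scope.
Local Open Scope ring_scope.

(* Euclidean spaces are taken in orthonormal coordinates: R^n is 'cV[R]_n, a
   linear operator K : R^n -> R^m is a matrix 'M[R]_(m, n), its adjoint is
   K^T.  The norm `|x| of the library on 'cV[R]_n is the sup norm; it is only
   used through the topology and the differentiability notion it induces
   (which are the Euclidean ones).  All quantitative bounds use enorm. *)
Definition dot (R : realType) (n : nat) (x y : 'cV[R]_n) : R :=
  \sum_(i < n) x i 0 * y i 0.

Definition enorm (R : realType) (n : nat) (x : 'cV[R]_n) : R :=
  Num.sqrt (dot x x).

Definition proper_fun (R : realType) (n : nat) (g : 'cV[R]_n -> \bar R) : Prop :=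
  (forall x, (-oo < g x)%E) /\ (exists x, (g x < +oo)%E).

(* Weights 0 and 1 are excluded: they carry no information, and this way no
   product 0 * +oo occurs. *)
Definition convex_efun (R : realType) (n : nat) (g : 'cV[R]_n -> \bar R) : Prop :=
  forall (x y : 'cV[R]_n) (t : R), 0 < t -> t < 1 ->
    (g (t *: x + (1 - t) *: y)%R <= t%:E * g x + (1 - t)%R%:E * g y)%E.

Definition strongly_convex_efun (R : realType) (n : nat) (mu : R)
    (g : 'cV[R]_n -> \bar R) : Prop :=
  0 < mu /\
  forall (x y : 'cV[R]_n) (t : R), 0 < t -> t < 1 ->
    (g (t *: x + (1 - t) *: y)%R + (mu / 2 * t * (1 - t) * enorm (x - y) ^+ 2)%R%:E
       <= t%:E * g x + (1 - t)%R%:E * g y)%E.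

Definition conjugate (R : realType) (n : nat) (f : 'cV[R]_n -> \bar R)
    (y : 'cV[R]_n) : \bar R :=
  ereal_sup (range (fun z : 'cV[R]_n => ((dot z y)%:E - f z)%E)).

Definition subdiff (R : realType) (n : nat) (g : 'cV[R]_n -> \bar R)
    (x : 'cV[R]_n) : set 'cV[R]_n :=
  [set v | g x \is a fin_num /\
           forall z, (g x + (dot v (z - x)%R)%:E <= g z)%E].

(* A set-valued map S is differentiable at x with derivative A if S x is a
   single vector v, S has nonempty values near x, and
   S z is contained in v + A (z - x) + o(|z - x|) B, B the unit ball. *)
Definition is_set_derivative (R : realType) (n k : nat)
    (S : 'cV[R]_n -> set 'cV[R]_k) (x : 'cV[R]_n) (A : 'M[R]_(k, n)) : Prop :=
  exists2 v : 'cV[R]_k, S x = [set v] &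
    forall eps : R, 0 < eps ->
      \forall z \near x, S z !=set0 /\
        forall u, S z u -> enorm (u - v - A *m (z - x)) <= eps * enorm (z - x).

Definition has_hessian (R : realType) (n : nat) (g : 'cV[R]_n -> \bar R)
    (x : 'cV[R]_n) : Prop :=
  exists H : 'M[R]_n, is_set_derivative (subdiff g) x H.

(* Alexandrov Hessian; 0 where it does not exist. *)
Definition hessian (R : realType) (n : nat) (g : 'cV[R]_n -> \bar R)
    (x : 'cV[R]_n) : 'M[R]_n :=
  xget 0 [set H | is_set_derivative (subdiff g) x H].

Definition gradient (R : realType) (n : nat) (l : 'cV[R]_n -> R)
    (x : 'cV[R]_n) : 'cV[R]_n :=
  \col_(i < n) 'd l x (delta_mx i 0 : 'cV[R]_n).

Definition lipschitz_gradient (R : realType) (n : nat) (L : R)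
    (l : 'cV[R]_n -> R) : Prop :=
  (forall x : 'cV[R]_n, differentiable l x) /\
  (forall x y : 'cV[R]_n,
     enorm (gradient l x - gradient l y) <= L * enorm (x - y)).

Definition saddle_point (R : realType) (T U : Type) (F : T -> U -> R)
    (x0 : T) (y0 : U) : Prop :=
  (forall y, F x0 y <= F x0 y0) /\ (forall x, F x0 y0 <= F x y0).

(* In the definitions below fs stands for the conjugate of f. *)
Definition quad_saddle_fun (R : realType) (n m : nat) (K : 'M[R]_(m, n))
    (g : 'cV[R]_n -> \bar R) (fs : 'cV[R]_m -> \bar R)
    (l1 : 'cV[R]_n -> R) (l2 : 'cV[R]_m -> R) (x : 'cV[R]_n) (y : 'cV[R]_m)
    (X : 'cV[R]_n) (Y : 'cV[R]_m) : R :=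
  dot (K *m X) Y + 2^-1 * dot (hessian g x *m X) X
  - 2^-1 * dot (hessian fs y *m Y) Y
  + dot (gradient l1 x) X + dot (gradient l2 y) Y.

Definition B1 (R : realType) (n m : nat) (K : 'M[R]_(m, n))
    (g : 'cV[R]_n -> \bar R) (fs : 'cV[R]_m -> \bar R)
    (x : 'cV[R]_n) (y : 'cV[R]_m) : 'M[R]_n :=
  hessian g x + K^T *m invmx (hessian fs y) *m K.

Definition B2 (R : realType) (n m : nat) (K : 'M[R]_(m, n))
    (g : 'cV[R]_n -> \bar R) (fs : 'cV[R]_m -> \bar R)
    (x : 'cV[R]_n) (y : 'cV[R]_m) : 'M[R]_m :=
  K *m invmx (hessian g x) *m K^T + hessian fs y.

Definition delta1 (R : realType) (n m : nat) (K : 'M[R]_(m, n))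
    (g : 'cV[R]_n -> \bar R) (fs : 'cV[R]_m -> \bar R)
    (l1 : 'cV[R]_n -> R) (l2 : 'cV[R]_m -> R) (mug : R)
    (X x : 'cV[R]_n) (y : 'cV[R]_m) : R :=
  enorm (B1 K g fs x y *m X + gradient l1 x
         + K^T *m invmx (hessian fs y) *m gradient l2 y) / mug.

Definition delta2 (R : realType) (n m : nat) (K : 'M[R]_(m, n))
    (g : 'cV[R]_n -> \bar R) (fs : 'cV[R]_m -> \bar R)
    (l1 : 'cV[R]_n -> R) (l2 : 'cV[R]_m -> R) (mufs : R)
    (Y : 'cV[R]_m) (x : 'cV[R]_n) (y : 'cV[R]_m) : R :=
  enorm (B2 K g fs x y *m Y + K *m invmx (hessian g x) *m gradient l1 x
         - gradient l2 y) / mufs.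

(* Main.v *)
(* Write A and B for the Hessians of g and f^*.  Cyclic monotonicity of the
   subdifferential passes to its derivative, so A and B are symmetric, and
   strong convexity makes them coercive with constants mu_g and mu_{f^*}.
   Hence a saddle point (X', Y') is characterized by A X' + K^T Y' + c = 0 and
   B Y' = K X' + e, with c and e the two gradients.  Eliminating either unknown
   gives a linear system for the Schur complement B1 or B2, which inherits the
   coercivity of A or B: the defect of X in the first system is B1 (X - X'),
   of norm at least mu_g |X - X'|, and similarly for Y. *)
Require Import Defs.
From HB Require Import structures.
From mathcomp Require Import all_boot all_order all_algebra.
From mathcomp Require Import all_classical all_reals all_analysis.
From mathcomp Require Import ring lra.

Set Implicit Arguments.
Unset Strict Implicit.
Unset Printing Implicit Defensive.

Import Order.TTheory GRing.Theory Num.Theory.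
Import numFieldNormedType.Exports.

Local Open Scope classical_set_scope.
Local Open Scope ring_scope.

(** * Inner product and Euclidean norm on column vectors *)

Section Euclidean.
Context {R : realType}.
Implicit Types n m : nat.

Lemma dot_mulmx n (x y : 'cV[R]_n) : dot x y = (x^T *m y) 0 0.
Proof. by rewrite mxE; apply: eq_bigr => i _; rewrite mxE. Qed.

Lemma dotC n (x y : 'cV[R]_n) : dot x y = dot y x.
Proof. by apply: eq_bigr => i _; rewrite mulrC. Qed.

Lemma dotDl n (x y z : 'cV[R]_n) : dot (x + y) z = dot x z + dot y z.
Proof. by rewrite !dot_mulmx linearD mulmxDl mxE. Qed.

Lemma dotZl n a (x y : 'cV[R]_n) : dot (a *: x) y = a * dot x y.
Proof. by rewrite !dot_mulmx linearZ -scalemxAl mxE. Qed.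

Lemma dotNl n (x y : 'cV[R]_n) : dot (- x) y = - dot x y.
Proof. by rewrite -scaleN1r dotZl mulN1r. Qed.

Lemma dotDr n (x y z : 'cV[R]_n) : dot x (y + z) = dot x y + dot x z.
Proof. by rewrite dotC dotDl !(dotC x). Qed.

Lemma dotZr n a (x y : 'cV[R]_n) : dot x (a *: y) = a * dot x y.
Proof. by rewrite dotC dotZl dotC. Qed.

Lemma dotNr n (x y : 'cV[R]_n) : dot x (- y) = - dot x y.
Proof. by rewrite dotC dotNl dotC. Qed.

Lemma dot0l n (x : 'cV[R]_n) : dot 0 x = 0.
Proof. by rewrite -(scale0r 0) dotZl mul0r. Qed.

Lemma dot0r n (x : 'cV[R]_n) : dot x 0 = 0.
Proof. by rewrite dotC dot0l. Qed.

Definition dotE := (dotDl, dotDr, dotNl, dotNr, dotZl, dotZr, dot0l, dot0r).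

Lemma dot_mulmxl n m (A : 'M[R]_(m, n)) x y :
  dot (A *m x) y = dot x (A^T *m y).
Proof. by rewrite !dot_mulmx trmx_mul mulmxA. Qed.

Lemma dot_ge0 n (x : 'cV[R]_n) : 0 <= dot x x.
Proof. by apply: sumr_ge0 => i _; rewrite -expr2 sqr_ge0. Qed.

Lemma dot_eq0 n (x : 'cV[R]_n) : dot x x = 0 -> x = 0.
Proof.
move=> /eqP; rewrite psumr_eq0 => [/allP x0|i _]; last by rewrite -expr2 sqr_ge0.
apply/matrixP => i j; rewrite ord1 mxE; apply/eqP.
by have := x0 i (mem_index_enum i); rewrite mulf_eq0 orbb.
Qed.

Lemma enorm_ge0 n (x : 'cV[R]_n) : 0 <= enorm x.
Proof. exact: sqrtr_ge0. Qed.

Lemma enorm_sqr n (x : 'cV[R]_n) : enorm x ^+ 2 = dot x x.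
Proof. by rewrite sqr_sqrtr ?dot_ge0. Qed.

Lemma enorm0 n : enorm (0 : 'cV[R]_n) = 0.
Proof. by rewrite /enorm dot0l sqrtr0. Qed.

Lemma enorm_le0 n (x : 'cV[R]_n) : enorm x <= 0 -> x = 0.
Proof.
move=> x0; apply: dot_eq0; rewrite -enorm_sqr.
have /eqP -> : enorm x == 0 by rewrite eq_le x0 enorm_ge0.
by rewrite expr0n.
Qed.

Lemma enormZ n a (x : 'cV[R]_n) : enorm (a *: x) = `|a| * enorm x.
Proof. by rewrite /enorm !dotE mulrA -expr2 sqrtrM ?sqr_ge0 // sqrtr_sqr. Qed.

Lemma enormN n (x : 'cV[R]_n) : enorm (- x) = enorm x.
Proof. by rewrite /enorm !dotE opprK. Qed.

Lemma cauchy_schwarz n (x y : 'cV[R]_n) : dot x y <= enorm x * enorm y.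
Proof.
rewrite -sqrtrM ?dot_ge0 //; apply: le_trans (ler_norm _) _.
rewrite -sqrtr_sqr ler_wsqrtr //.
have [y0|yN0] := eqVneq (dot y y) 0.
  by rewrite (dot_eq0 y0) !dotE expr0n mulr0.
have yy : 0 < dot y y by rewrite lt_def yN0 dot_ge0.
(* The squared norm of this vector is [dot y y] times the Cauchy-Schwarz defect. *)
have := dot_ge0 (dot y y *: x - dot x y *: y).
rewrite !dotE (dotC y x) => h.
rewrite -subr_ge0 -(pmulr_rge0 _ yy).
by apply: le_trans h _; rewrite le_eqVlt; apply/orP; left; apply/eqP; ring.
Qed.

Lemma enormD n (x y : 'cV[R]_n) : enorm (x + y) <= enorm x + enorm y.
Proof.
rewrite -(@ler_pXn2r _ 2) ?nnegrE ?addr_ge0 ?enorm_ge0 // enorm_sqr !dotE.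
rewrite (dotC y x) sqrrD !enorm_sqr.
by have := cauchy_schwarz x y; lra.
Qed.

(** Turns Euclidean bounds into membership in the sup-norm balls that define neighbourhoods. *)
Lemma le_norm_enorm n (x : 'cV[R]_n) : `|x| <= enorm x.
Proof.
rewrite [leLHS]mx_normrE; apply: bigmax_le => [|[i j] _]; first exact: enorm_ge0.
rewrite /= ord1 -sqrtr_sqr ler_wsqrtr // /dot (bigD1 i) //= -expr2 lerDl.
by apply: sumr_ge0 => k _; rewrite -expr2 sqr_ge0.
Qed.

End Euclidean.

(** * Coercivity and symmetry of the derivative of a subdifferential *)

Section Hessian.
Context {R : realType} {n : nat}.
Implicit Types (g : 'cV[R]_n -> \bar R) (A : 'M[R]_n) (x z u v d : 'cV[R]_n).

(** Compare strong convexity on the segment from [x] to [z] with the subgradient inequality at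
    weight [t], divide by [t] and let [t] tend to 0. *)
Lemma strong_subgradient g mu x u z : strongly_convex_efun mu g ->
  subdiff g x u -> g z \is a fin_num ->
  fine (g x) + dot u (z - x) + mu / 2 * dot (z - x) (z - x) <= fine (g z).
Proof.
move=> [mu0 g_conv] [gx gu] gz.
apply/ler_addgt0Pr => e e0.
set D := dot (z - x) (z - x).
have D0 : 0 <= D by exact: dot_ge0.
(* Small enough that the loss [mu / 2 * t * D] stays below [e]; the added 1 and [e] keep [t]
   strictly between 0 and 1. *)
pose t := e / (mu * (D + 1) + e).
have den : 0 < mu * (D + 1) + e by rewrite addr_gt0 // mulr_gt0 // ltr_wpDl.
have t0 : 0 < t by rewrite divr_gt0.
have t1 : t < 1 by rewrite ltr_pdivrMr // mul1r ltrDr mulr_gt0 // ltr_wpDl.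
have te : mu * D * t <= e.
  rewrite mulrA ler_pdivrMr // [mu * D * e]mulrC ler_wpM2l ?ltW //.
  by lra.
have := g_conv z x t t0 t1; have := gu (t *: z + (1 - t) *: x).
have -> : t *: z + (1 - t) *: x - x = t *: (z - x).
  by rewrite scalerBl scale1r scalerBr addrA addrAC addrK.
rewrite enorm_sqr -/D dotZr -(fineK gx) -(fineK gz).
move: (g (t *: z + _)) => [r| |] //; rewrite -!EFinM -!EFinD !lee_fin => h1 h2.
rewrite -(ler_pM2l t0) !mulrDr.
have : t * (mu * D * t) <= t * e by rewrite ler_pM2l.
have mD : 0 <= t * (mu * D * t) by apply: mulr_ge0 (ltW t0) (mulr_ge0 (mulr_ge0 (ltW mu0) D0) (ltW t0)).
by lra.
Qed.

(* Rescaling [g] around the point of differentiability, [q a] being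
   [(g (x + t a) - t <v, a>) / t^2] with [t] small, makes [a |-> A a] an
   approximate strong subgradient on a large ball. *)
Lemma set_derivative_potential g mu x A (M eps : R) :
  strongly_convex_efun mu g -> is_set_derivative (subdiff g) x A ->
  0 < M -> 0 < eps ->
  exists q : 'cV[R]_n -> R, forall a b, enorm a <= M -> enorm b <= M ->
    dot (A *m a) (b - a) + mu / 2 * dot (b - a) (b - a) - eps <= q b - q a.
Proof.
move=> g_conv [v gx dg] M0 eps0.
have MM : 0 < 2 * M * M by rewrite !mulr_gt0.
(* The remainder at [x + t a] is then at most [eps / (2 M^2) * t M]; paired with [b - a], of norm at
   most [2 M], it costs at most [t * eps]. *)
have /dg /nbhs_ballP[r /= r0 near_r] : 0 < eps / (2 * M * M) by rewrite divr_gt0.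
pose t := r / (2 * M).
have t0 : 0 < t by rewrite divr_gt0 // mulr_gt0.
have inball a : enorm a <= M -> ball x r (x + t *: a).
  move=> aM; rewrite -ball_normE /= opprD addNKr normrN.
  apply: le_lt_trans (le_norm_enorm _) _; rewrite enormZ gtr0_norm //.
  apply: (@le_lt_trans _ _ (t * M)); first by rewrite ler_pM2l.
  by rewrite /t -mulrA invfM -mulrA mulVf ?gt_eqF //; lra.
exists (fun a => (fine (g (x + t *: a)) - t * dot v a) / t ^+ 2) => a b aM bM.
have [[u ua] du] := near_r _ (inball a aM).
have [[w [gb _]] _] := near_r _ (inball b bM).
have := strong_subgradient g_conv ua gb.
have := du u ua.
have -> : x + t *: b - (x + t *: a) = t *: (b - a).
  by rewrite opprD addrACA subrr add0r scalerBr.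
have -> : x + t *: a - x = t *: a by rewrite addrAC subrr add0r.
rewrite -scalemxAr enormZ gtr0_norm // dotZr.
set e := u - v - _ => eM.
have -> : u = v + t *: (A *m a) + e by rewrite /e -[u - v - _]addrA -opprD subrKC.
move=> sub.
have eba : - (t * eps) <= dot e (b - a).
  have := cauchy_schwarz (- e) (b - a); rewrite dotNl enormN => cs.
  have ba : enorm (b - a) <= 2 * M.
    by apply: le_trans (enormD _ _) _; rewrite enormN; lra.
  have : enorm e * enorm (b - a) <= t * eps; last by lra.
  have -> : t * eps = eps / (2 * M * M) * (t * M) * (2 * M).
    by field; rewrite gt_eqF.
  apply: ler_pM; rewrite ?enorm_ge0 //; apply: le_trans eM _.
  by rewrite ler_pM2l ?divr_gt0 // ler_pM2l.
rewrite -mulrBl ler_pdivlMr ?exprn_gt0 //.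
have : t * - (t * eps) <= t * dot e (b - a) by rewrite ler_pM2l.
move: sub; rewrite !dotE; nra.
Qed.

(** Adding the potential inequalities from 0 to [d] and from [d] to 0 cancels [q]. *)
Lemma set_derivative_coercive g mu x A d :
  strongly_convex_efun mu g -> is_set_derivative (subdiff g) x A ->
  mu * dot d d <= dot (A *m d) d.
Proof.
move=> g_conv dA; apply/ler_addgt0Pr => e e0.
have M0 : 0 < enorm d + 1 by rewrite ltr_wpDl ?enorm_ge0.
have e2 : 0 < e / 2 by rewrite divr_gt0.
have [q Hq] := set_derivative_potential g_conv dA M0 e2.
have dM : enorm d <= enorm d + 1 by rewrite lerDl.
have zM : enorm (0 : 'cV[R]_n) <= enorm d + 1 by rewrite enorm0 ltW.
have := Hq 0 d zM dM; have := Hq d 0 dM zM.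
by rewrite mulmx0 sub0r subr0 !dotE; lra.
Qed.

(** Summing over [N] equal steps gives the left Riemann sum of [<A (p + s d), d>] for [s] in [0, 1]:
    its integral, less the discretization term [<A d, d> / (2 N)], with an error [eps] per step. *)
Lemma potential_segment A (q : 'cV[R]_n -> R) (M eps : R) (N : nat) p d :
  (forall a b, enorm a <= M -> enorm b <= M ->
    dot (A *m a) (b - a) - eps <= q b - q a) ->
  enorm p <= M -> enorm (p + d) <= M -> (0 < N)%N ->
  dot (A *m p) d + dot (A *m d) d / 2 - dot (A *m d) d / (2 * N%:R) - N%:R * eps
    <= q (p + d) - q p.
Proof.
move=> Hq pM pdM N0; have N0' : (0 : R) < N%:R by rewrite ltr0n.
have inM k : (k <= N)%N -> enorm (p + (k%:R / N%:R) *: d) <= M.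
  move=> kN; set s := k%:R / _.
  have s0 : 0 <= s by rewrite divr_ge0.
  have s1 : s <= 1 by rewrite ler_pdivrMr // mul1r ler_nat.
  have -> : p + s *: d = (1 - s) *: p + s *: (p + d).
    by rewrite scalerBl scale1r scalerDr addrA subrK.
  apply: le_trans (enormD _ _) _; rewrite !enormZ !ger0_norm ?subr_ge0 //.
  have : (1 - s) * enorm p <= (1 - s) * M by rewrite ler_wpM2l ?subr_ge0.
  have : s * enorm (p + d) <= s * M by rewrite ler_wpM2l.
  lra.
(* Partial sum after [k] steps; [k (k - 1) / 2] is the sum of the indices below [k]. *)
have step k : (k <= N)%N ->
    k%:R / N%:R * dot (A *m p) d
      + dot (A *m d) d * (k%:R * (k%:R - 1)) / (2 * N%:R ^+ 2) - k%:R * eps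
    <= q (p + (k%:R / N%:R) *: d) - q p.
  elim: k => [_|k IH kN]; first by rewrite !mul0r scale0r addr0 !(mulr0, mul0r); lra.
  have := Hq _ _ (inM _ (ltnW kN)) (inM _ kN); have := IH (ltnW kN).
  rewrite opprD addrACA subrr add0r -scalerBl -(natr1 k).
  rewrite mulmxDr -scalemxAr !dotE.
  set P := dot _ d; set D := dot _ d; set N' := N%:R; set k' := k%:R => h1 h2.
  have -> : (k' + 1) / N' * P + D * ((k' + 1) * (k' + 1 - 1)) / (2 * N' ^+ 2)
     - (k' + 1) * eps = (k' / N' * P + D * (k' * (k' - 1)) / (2 * N' ^+ 2)
     - k' * eps) + (((k' + 1) / N' - k' / N') * (P + k' / N' * D) - eps).
    by field; rewrite gt_eqF.
  lra.
have := step N (leqnn _); rewrite divff ?gt_eqF // scale1r mul1r.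
have -> // : dot (A *m d) d * (N%:R * (N%:R - 1)) / (2 * N%:R ^+ 2) =
  dot (A *m d) d / 2 - dot (A *m d) d / (2 * N%:R).
  by field; rewrite gt_eqF.
by rewrite addrA.
Qed.

(* Cyclic monotonicity along the finely subdivided triangle [0, a, b]. *)
Lemma set_derivative_dot_le g mu x A a b :
  strongly_convex_efun mu g -> is_set_derivative (subdiff g) x A ->
  dot (A *m a) b <= dot (A *m b) a.
Proof.
move=> g_conv dA.
pose M := enorm a + enorm b + 1.
have a0 := enorm_ge0 a; have b0 := enorm_ge0 b.
have M0 : 0 < M by rewrite /M; lra.
(* Around the triangle [q] cancels and the integrals add up to half of [<A a, b> - <A b, a>]. Twice
   the remaining terms is [C / N]: the three discretization terms, and 6 from three sides with [N]
   errors [1 / N^2] each. *)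
pose C := dot (A *m a) a + dot (A *m (b - a)) (b - a) + dot (A *m b) b + 6.
apply/ler_addgt0Pr => e e0.
pose N := (Num.truncn (`|C| / e)).+1.
have N0 : (0 : R) < N%:R by rewrite ltr0n.
have CN : C / N%:R <= e.
  rewrite ler_pdivrMr //; apply: le_trans (ler_norm _) _.
  by rewrite mulrC -ler_pdivrMr // ltW // /N truncnS_gt.
have NN0 : (0 : R) < (N%:R ^+ 2)^-1 by rewrite invr_gt0 exprn_gt0.
have [q Hq] := set_derivative_potential g_conv dA M0 NN0.
have {}Hq c d : enorm c <= M -> enorm d <= M ->
    dot (A *m c) (d - c) - (N%:R ^+ 2)^-1 <= q d - q c.
  move=> cM dM; have := Hq c d cM dM.
  have : 0 <= mu / 2 * dot (d - c) (d - c).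
    by rewrite mulr_ge0 ?dot_ge0 // divr_ge0 // ltW // g_conv.1.
  lra.
have seg c d cM dM := @potential_segment A q M _ N c (d - c) Hq cM dM (ltn0Sn _).
have zM : enorm (0 : 'cV[R]_n) <= M by rewrite enorm0 ltW.
have aM : enorm a <= M by rewrite /M; lra.
have bM : enorm b <= M by rewrite /M; lra.
have := seg 0 a zM; have := seg a b aM; have := seg b 0 bM.
rewrite !(addrC _ (_ - _)) !subrK => /(_ zM) h1 /(_ bM) h2 /(_ aM) h3.
have NN : N%:R * (N%:R ^+ 2)^-1 = N%:R^-1 :> R by field; rewrite gt_eqF.
move: CN h1 h2 h3; rewrite NN /C !(mulmx0, sub0r, subr0, mulmxBr, mulmxN, dotE) invfM.
lra.
Qed.

(** Exchanging [a] and [b] makes the previous inequality an equality; basis vectors read off the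
    entries. *)
Lemma set_derivative_sym g mu x A :
  strongly_convex_efun mu g -> is_set_derivative (subdiff g) x A -> A^T = A.
Proof.
move=> g_conv dA; apply/trmx_inj/matrixP => i j; rewrite trmxK mxE.
have dotA k h : dot (A *m delta_mx k 0) (delta_mx h 0) = A h k.
  rewrite -colE /dot (bigD1 h) //= big1 ?addr0 => [|l lh]; rewrite !mxE ?eqxx ?mulr1 //.
  by rewrite (negbTE lh) mulr0.
rewrite -!dotA; apply/eqP.
by rewrite eq_le !(set_derivative_dot_le _ _ g_conv dA).
Qed.

End Hessian.

(** * Coercive matrices, quadratic saddle points and Schur complements *)

Section Saddle.
Context {R : realType}.
Implicit Types n m : nat.

Lemma hessianP n (g : 'cV[R]_n -> \bar R) x :
  has_hessian g x -> is_set_derivative (subdiff g) x (hessian g x).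
Proof. exact: xgetPex. Qed.

Lemma coercive_enorm n mu (A : 'M[R]_n) d :
  (forall d, mu * dot d d <= dot (A *m d) d) -> mu * enorm d <= enorm (A *m d).
Proof.
move=> coA; have [d0|] := eqVneq (enorm d) 0; first by rewrite d0 mulr0 enorm_ge0.
move=> dN0; have d0 : 0 < enorm d by rewrite lt_def dN0 enorm_ge0.
rewrite -(ler_pM2r d0) -mulrA -expr2 enorm_sqr.
exact: le_trans (coA d) (cauchy_schwarz _ _).
Qed.

(** Coercivity forces the kernel to be trivial. The transpose appears because [kermx] acts on row
    vectors. *)
Lemma coercive_unitmx n mu (A : 'M[R]_n) : 0 < mu ->
  (forall d, mu * dot d d <= dot (A *m d) d) -> A \in unitmx.
Proof.
move=> mu0 coA; rewrite -unitmx_tr -row_free_unit; apply/row_freeP.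
have injA (v : 'rV_n) : v *m A^T = 0 -> v = 0.
  move=> vA; apply: trmx_inj; rewrite trmx0; apply: enorm_le0.
  rewrite -(pmulr_rle0 _ mu0); apply: le_trans (coercive_enorm _ coA) _.
  by rewrite -[A]trmxK -trmx_mul vA trmx0 enorm0.
apply/row_freeP; rewrite -kermx_eq0; apply/eqP/row_matrixP => i.
by rewrite row0; apply: injA; apply/sub_kermxP; rewrite row_sub.
Qed.

Lemma coercive_ge0 n mu (A : 'M[R]_n) d : 0 < mu ->
  (forall d, mu * dot d d <= dot (A *m d) d) -> 0 <= dot (A *m d) d.
Proof.
by move=> mu0 coA; apply: le_trans (coA d); rewrite mulr_ge0 ?dot_ge0 // ltW.
Qed.

(** With [w = A^-1 d] the form becomes [<w, A w>]. *)
Lemma invmx_ge0 n (A : 'M[R]_n) d : A \in unitmx ->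
  (forall d, 0 <= dot (A *m d) d) -> 0 <= dot (invmx A *m d) d.
Proof. by move=> uA A0; rewrite -{2}(mulKVmx uA d) dotC. Qed.

Lemma quad_minimizer n (A : 'M[R]_n) (b x0 : 'cV[R]_n) : A^T = A ->
  (forall d, 0 <= dot (A *m d) d) ->
  (forall x, 2^-1 * dot (A *m x0) x0 + dot b x0 <= 2^-1 * dot (A *m x) x + dot b x)
    <-> A *m x0 + b = 0.
Proof.
move=> symA A0.
(* Exact second-order expansion at [x0]; symmetry of [A] merges the two cross terms. *)
have expand d : 2^-1 * dot (A *m (x0 + d)) (x0 + d) + dot b (x0 + d) =
  2^-1 * dot (A *m x0) x0 + dot b x0 + (dot (A *m x0 + b) d + 2^-1 * dot (A *m d) d).
  have : dot (A *m d) x0 = dot (A *m x0) d by rewrite dot_mulmxl symA dotC.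
  by rewrite mulmxDr !dotE => ->; field.
split=> [min_x0|crit x]; last first.
  rewrite -(subrKC x0 x) expand crit dot0l add0r lerDl.
  by rewrite mulr_ge0 ?A0 // invr_ge0.
set r := A *m x0 + b; apply: dot_eq0.
set D := dot r r; set E := dot (A *m r) r.
have D0 : 0 <= D by exact: dot_ge0.
have E0 : 0 <= E by exact: A0.
have E1 : 0 < E + 1 by rewrite ltr_wpDl.
(* Steepest descent from [x0] with a step short enough to decrease unless [r = 0]. *)
pose t := D / (E + 1).
have := min_x0 (x0 + (- t) *: r); rewrite expand lerDl -/r -scalemxAr !(dotZl, dotZr) -/D -/E.
have -> : - t * D + 2^-1 * (- t * (- t * E)) = - ((t / (E + 1)) * (D * (E / 2 + 1))).
  by rewrite /t; field; rewrite gt_eqF.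
rewrite oppr_ge0 => le0.
have DD : D * D <= 0.
  have : (D * D) * (E / 2 + 1) / (E + 1) ^+ 2 <= 0.
    apply: le_trans le0; rewrite le_eqVlt; apply/orP; left; apply/eqP.
    by rewrite /t; field; rewrite gt_eqF.
  rewrite pmulr_lle0 ?invr_gt0 ?exprn_gt0 // pmulr_lle0 //; lra.
by apply/eqP; rewrite -sqrf_eq0 eq_le expr2 DD mulr_ge0.
Qed.

(** For fixed [Y] the function is a convex quadratic in [X], and for fixed [X] its negative is one
    in [Y]; each optimality condition is a linear equation. *)
Lemma quad_saddleP n m (K : 'M[R]_(m, n)) g fs l1 l2 x y X Y :
  (hessian g x)^T = hessian g x -> (hessian fs y)^T = hessian fs y ->
  (forall d, 0 <= dot (hessian g x *m d) d) ->
  (forall d, 0 <= dot (hessian fs y *m d) d) ->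
  saddle_point (quad_saddle_fun K g fs l1 l2 x y) X Y <->
  hessian g x *m X + K^T *m Y + gradient l1 x = 0 /\
  hessian fs y *m Y = K *m X + gradient l2 y.
Proof.
rewrite /saddle_point /quad_saddle_fun.
move: (hessian g x) (hessian fs y) (gradient l1 x) (gradient l2 y).
move=> A B c e symA symB A0 B0.
have := quad_minimizer (K^T *m Y + c) X symA A0.
have := quad_minimizer (- (K *m X + e)) Y symB B0.
have dotK Z W : dot (K *m Z) W = dot (K^T *m W) Z by rewrite dot_mulmxl dotC.
rewrite addrA => -[minY critY] [minX critX]; split=> [[maxY minX']|[eqX eqY]].
  split.
    by apply: minX => Z; have := minX' Z; rewrite !dotK !dotE; lra.
  apply/eqP; rewrite -subr_eq0; apply/eqP/minY => Z.
  by have := maxY Z; rewrite !dotE; lra.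
split=> [Z|Z].
  have : B *m Y - (K *m X + e) = 0 by rewrite eqY subrr.
  by move=> /critY/(_ Z); rewrite !dotE; lra.
by have := critX eqX Z; rewrite !dotK !dotE; lra.
Qed.

(** The added term contributes [<B^-1 K d, K d>], which is nonnegative. *)
Lemma schur_coercive n m mu (A : 'M[R]_n) (B : 'M[R]_m) (K : 'M[R]_(m, n)) d :
  (forall d, mu * dot d d <= dot (A *m d) d) -> B \in unitmx ->
  (forall d, 0 <= dot (B *m d) d) ->
  mu * dot d d <= dot ((A + K^T *m invmx B *m K) *m d) d.
Proof.
move=> coA uB B0; rewrite mulmxDl dotDl; apply: le_trans (coA d) _.
by rewrite lerDl -!mulmxA dot_mulmxl trmxK invmx_ge0.
Qed.

Section Block.
Variables (n m : nat) (A : 'M[R]_n) (B : 'M[R]_m) (K : 'M[R]_(m, n)).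
Variables (c X : 'cV[R]_n) (e Y : 'cV[R]_m).

(** Solve the second equation for [Y] and substitute. The equivalence serves both existence and
    uniqueness. *)
Lemma schur_primal : B \in unitmx ->
  A *m X + K^T *m Y + c = 0 /\ B *m Y = K *m X + e <->
  (A + K^T *m invmx B *m K) *m X + c + K^T *m invmx B *m e = 0 /\
  Y = invmx B *m (K *m X + e).
Proof.
move=> uB.
have eqX : (A + K^T *m invmx B *m K) *m X + c + K^T *m invmx B *m e =
    A *m X + K^T *m (invmx B *m (K *m X + e)) + c.
  by rewrite mulmxDl !mulmxDr -!mulmxA addrAC !addrA.
rewrite eqX; split=> [[eq1 eq2]|[eq1 ->]].
  by rewrite -eq2 mulKmx.
by rewrite mulKVmx.
Qed.

(** Substitute [X = - A^-1 (K^T Y + c)] in the second equation. *)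
Lemma schur_dual : A \in unitmx ->
  A *m X + K^T *m Y + c = 0 -> B *m Y = K *m X + e ->
  (K *m invmx A *m K^T + B) *m Y + K *m invmx A *m c - e = 0.
Proof.
move=> uA eq1 eq2.
have AX : A *m X = - (K^T *m Y + c) by apply/eqP; rewrite -addr_eq0 addrA eq1.
rewrite mulmxDl eq2 -(mulKmx uA X) AX !mulmxN -!mulmxA !mulmxDr.
rewrite opprD; set a := K *m _; set b := K *m _.
by rewrite -(addrA (- a)) addNKr (addrAC (- b)) addNr add0r subrr.
Qed.

End Block.

(** Since [X0] solves the system, the residual at [X] is [A (X - X0)]. *)
Lemma coercive_residual n mu (A : 'M[R]_n) (r X X0 : 'cV[R]_n) : 0 < mu ->
  (forall d, mu * dot d d <= dot (A *m d) d) -> A *m X0 + r = 0 ->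
  enorm (X - X0) <= enorm (A *m X + r) / mu.
Proof.
move=> mu0 coA eq0; rewrite ler_pdivlMr // mulrC.
have -> : A *m X + r = A *m (X - X0).
  rewrite mulmxBr; congr (_ + _); apply/eqP.
  by rewrite -addr_eq0 addrC eq0.
exact: coercive_enorm.
Qed.

End Saddle.

Theorem lemma3 (R : realType) (n m : nat) (K : 'M[R]_(m, n))
    (f : 'cV[R]_m -> \bar R) (g : 'cV[R]_n -> \bar R)
    (mufs mug L1 L2 : R)
    (l : 'cV[R]_n -> 'cV[R]_m -> R) (l1 : 'cV[R]_n -> R) (l2 : 'cV[R]_m -> R)
    (xt : 'cV[R]_n) (yt : 'cV[R]_m)
    (f_proper : proper_fun f) (f_convex : convex_efun f)
    (f_lsc : lower_semicontinuous f)
    (g_proper : proper_fun g) (g_convex : convex_efun g)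
    (g_lsc : lower_semicontinuous g)
    (fs_strong : strongly_convex_efun mufs (conjugate f))
    (g_strong : strongly_convex_efun mug g)
    (l_sum : forall x y, l x y = l1 x + l2 y)
    (l_ge0 : forall x y, 0 <= l x y)
    (l1_smooth : lipschitz_gradient L1 l1)
    (l2_smooth : lipschitz_gradient L2 l2)
    (g_hess : has_hessian g xt)
    (fs_hess : has_hessian (conjugate f) yt) :
  let F := quad_saddle_fun K g (conjugate f) l1 l2 xt yt in
  (exists! p : 'cV[R]_n * 'cV[R]_m, saddle_point F p.1 p.2) /\
  (forall (Xb : 'cV[R]_n) (Yb : 'cV[R]_m), saddle_point F Xb Yb ->
    forall (X : 'cV[R]_n) (Y : 'cV[R]_m),
      enorm (X - Xb) <= delta1 K g (conjugate f) l1 l2 mug X xt yt /\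
      enorm (Y - Yb) <= delta2 K g (conjugate f) l1 l2 mufs Y xt yt).
Proof.
move=> F.
have mug0 := g_strong.1; have mufs0 := fs_strong.1.
have dg := hessianP g_hess; have dfs := hessianP fs_hess.
have coA d := set_derivative_coercive d g_strong dg.
have coB d := set_derivative_coercive d fs_strong dfs.
have A0 d := coercive_ge0 d mug0 coA; have B0 d := coercive_ge0 d mufs0 coB.
have uA := coercive_unitmx mug0 coA; have uB := coercive_unitmx mufs0 coB.
have saddleP X Y := quad_saddleP K l1 l2 X Y (set_derivative_sym g_strong dg)
  (set_derivative_sym fs_strong dfs) A0 B0.
have coB1 d : mug * dot d d <= dot (B1 K g (conjugate f) xt yt *m d) d.
  exact: schur_coercive.
have coB2 d : mufs * dot d d <= dot (B2 K g (conjugate f) xt yt *m d) d.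
  (* [B2] is the Schur complement with the two Hessians exchanged and [K^T] in place of [K]. *)
  by have := schur_coercive K^T d coB uA A0; rewrite trmxK addrC.
pose r1 := gradient l1 xt
  + K^T *m invmx (hessian (conjugate f) yt) *m gradient l2 yt.
have schur X Y := schur_primal (hessian g xt) K (gradient l1 xt) X
  (gradient l2 yt) Y uB.
split.
  pose X := - (invmx (B1 K g (conjugate f) xt yt) *m r1).
  have B1X : B1 K g (conjugate f) xt yt *m X + r1 = 0.
    by rewrite mulmxN mulKVmx ?addNr //; exact: coercive_unitmx mug0 coB1.
  exists (X, invmx (hessian (conjugate f) yt) *m (K *m X + gradient l2 yt)).
  split=> [|[X' Y'] /saddleP/schur[/= eqX' ->]] /=.
    by apply/saddleP/schur; split=> //; rewrite -addrA.
  (* Uniqueness follows from the error bound: [X'] has zero residual, so its distance to [X] is at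
     most 0. *)
  suff -> : X' = X by [].
  apply/eqP; rewrite -subr_eq0; apply/eqP/enorm_le0.
  apply: le_trans (coercive_residual X' mug0 coB1 B1X) _.
  by rewrite /r1 addrA eqX' enorm0 mul0r.
move=> Xb Yb /saddleP crit X Y; split.
  rewrite /delta1 -addrA; apply: coercive_residual => //.
  by rewrite addrA; case/schur: crit.
rewrite /delta2 -addrA; apply: coercive_residual => //.
by rewrite addrA; case: crit; exact: schur_dual.
Qed.
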